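(* For every singular cardinal $\lambda$ of countable cofinality there is a $(\lambda,\lambda^+)$-graph of type $T_\lambda$ that does not have an $(\aleph_0,\lambda^+)$-subgraph.
   Context: For infinite cardinals $\lambda<\kappa$, a $(\lambda,\kappa)$-graph is a bipartite graph with bipartition $(A,B)$, $|A|=\lambda$, $|B|=\kappa$, in which every $b\in B$ has infinitely many neighbours in $A$. An $(\lambda',\kappa)$-subgraph of it is a subgraph with bipartition $(C,D)$, $C\subseteq A$, $D\subseteq B$, that is itself a $(\lambda',\kappa)$-graph. For a cardinal $\lambda$, $T_\lambda$ is the order tree of all sequences of elements of $\lambda$ of length at most $\omega$ (including the empty sequence), ordered by initial segment; $T_\lambda^{<\omega}$ consists of the finite sequences and $T_\lambda^\omega$ of the $\omega$-sequences. For $\kappa>\lambda$, the down-closure $T$ of a $\kappa$-sized set $X\subseteq T_\lambda^\omega$ is a $\lambda$-tree with $\kappa$ tops (the tops being the elements of $X$). A $T$-graph is a graph with vertex set $T$ in which the endvertices of every edge are comparable and for every $t$ the neighbours of $t$ below $t$ are cofinal in $\{s : s<t\}$. A $(\lambda,\kappa)$-graph of type $T_\lambda$ is the bipartite graph with bipartition classes $T^{<\omega}$ and $X$ formed by the edges between these sets of some $T$-graph, where $T$ is a $\lambda$-tree with $\kappa$ tops $X$. *)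

(* Defs.v *)
(* cardinals are represented by types, compared via injections. *)
From Stdlib Require Import List.
Import ListNotations.

Set Implicit Arguments.

Definition card_le (A B : Type) : Prop := exists f : A -> B, forall x y, f x = f y -> x = y.
Definition card_eq (A B : Type) : Prop :=
  exists (f : A -> B) (g : B -> A), (forall x, g (f x) = x) /\ (forall y, f (g y) = y).
Definition card_lt (A B : Type) : Prop := card_le A B /\ ~ card_le B A.

Definition finite_type (A : Type) : Prop := exists l : list A, forall x, In x l.
Definition infinite_type (A : Type) : Prop := ~ finite_type A.

(** [L] has the cardinality of a singular cardinal of countable cofinality:
    it is uncountable and is the union of countably many subsets each of
    strictly smaller cardinality (i.e. cf(|L|) = omega < |L|). *)
Definition singular_countable_cof (L : Type) : Prop :=
  ~ card_le L nat /\
  exists A : nat -> L -> Prop,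
    (forall x, exists n, A n x) /\ (forall n, card_lt {x : L | A n x} L).

Definition is_successor_card (L K : Type) : Prop :=
  card_lt L K /\
  forall Y : K -> Prop, card_le {y : K | Y y} L \/ card_le K {y : K | Y y}.

Definition lk_graph (Lam Kap VA VB : Type) (A : VA -> Prop) (B : VB -> Prop)
  (E : VA -> VB -> Prop) : Prop :=
  card_eq {a : VA | A a} Lam /\ card_eq {b : VB | B b} Kap /\
  forall b, B b -> infinite_type {a : VA | A a /\ E a b}.

Definition has_aleph0_subgraph (Kap VA VB : Type) (A : VA -> Prop) (B : VB -> Prop)
  (E : VA -> VB -> Prop) : Prop :=
  exists (C : VA -> Prop) (D : VB -> Prop) (E' : VA -> VB -> Prop),
    (forall a, C a -> A a) /\ (forall b, D b -> B b) /\
    (forall a b, E' a b -> E a b) /\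
    lk_graph nat Kap C D E'.

Inductive tnode (L : Type) : Type :=
| Fin : list L -> tnode L
| Inf : (nat -> L) -> tnode L.
Arguments Fin {L} _.
Arguments Inf {L} _.

Definition prefix_of (L : Type) (s : list L) (f : nat -> L) : Prop :=
  s = map f (seq 0 (length s)).

Definition tlt (L : Type) (u v : tnode L) : Prop :=
  match u, v with
  | Fin s, Fin t => exists w, w <> [] /\ t = s ++ w
  | Fin s, Inf f => prefix_of s f
  | Inf _, _ => False
  end.

Definition tle (L : Type) (u v : tnode L) : Prop := u = v \/ tlt u v.

Definition comparable (L : Type) (u v : tnode L) : Prop := tle u v \/ tle v u.

Definition downclosure (L : Type) (X : (nat -> L) -> Prop) (u : tnode L) : Prop :=
  match u with
  | Fin s => exists f, X f /\ prefix_of s f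
  | Inf f => X f
  end.

Definition T_graph (L : Type) (X : (nat -> L) -> Prop) (G : tnode L -> tnode L -> Prop) : Prop :=
  (forall u v, G u v -> downclosure X u /\ downclosure X v) /\
  (forall u v, G u v -> G v u) /\
  (forall u, ~ G u u) /\
  (forall u v, G u v -> comparable u v) /\
  (forall t, downclosure X t ->
     forall s, tlt s t -> exists r, tle s r /\ tlt r t /\ G r t).

Definition Tfin (L : Type) (X : (nat -> L) -> Prop) (s : list L) : Prop :=
  downclosure X (Fin s).
Definition Tedge (L : Type) (G : tnode L -> tnode L -> Prop) (s : list L) (f : nat -> L) : Prop :=
  G (Fin s) (Inf f).

Definition graph_of_type_T (L K : Type) (X : (nat -> L) -> Prop)
  (G : tnode L -> tnode L -> Prop) : Prop :=
  card_eq {f : nat -> L | X f} K /\ T_graph X G /\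
  lk_graph L K (Tfin X) X (Tedge G).

(* Main.v *)
(** Well-order a set [K] of size [lambda^+] so that its initial segments have
    size at most [lambda], and filter the order of [K] by increasing transitive
    relations [G n] whose initial segments have size less than [lambda].  Colour
    [K] greedily with [lambda] colours so that [G n]-related points get distinct
    colours; the colours of [a] for all [n] form a branch of the tree, and every
    branch is joined to all of its finite initial segments.  Countably many
    nodes of a hypothetical [(aleph_0, lambda^+)]-subgraph leave only countably
    many values for each coordinate of [lambda^+] many branches, which is
    impossible once every set of [lambda^+] points contains an uncountable
    [G n]-chain for some [n].

    Such chains come from Shelah's argument for the existence of scales.  The
    relations [G n] can be arranged so that every point [a] of cofinality
    [omega_3] lies [G 0]-above the points of a club of [a].  Given a large set
    [U], build an increasing [omega_3]-sequence in [K] that anticipates all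
    members of a club guessing family; its limit [a] lies [G 0]-above the
    partial limits at an uncountable guessed set, and between consecutive ones
    of these one finds elements of [U] forming a chain on an uncountable
    subset. *)
From HB Require Import structures.
From mathcomp Require Import ssreflect ssrfun ssrbool eqtype choice order.
From mathcomp Require Import wochoice.
From mathcomp Require Import boolp classical_sets functions cardinality.
From Stdlib Require Import List Lia Wellfounded.
From Stdlib Require Import Relation_Operators Operators_Properties.
Require Import Defs.

Set Implicit Arguments.
Unset Strict Implicit.
Unset Printing Implicit Defensive.

Import Order.TTheory.
Local Open Scope order_scope.
Local Open Scope classical_set_scope.
Local Open Scope card_scope.

(** * Well-ordered types *)

HB.mixin Record isWellFounded (d : Order.disp_t) W of Order.Total d W := {
  lt_wf : well_founded (fun x y : W => x < y) }.

#[short(type="wellOrderType")]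
HB.structure Definition WellOrder (d : Order.disp_t) :=
  {W of Order.Total d W & isWellFounded d W}.

Lemma ex_minimum d (W : wellOrderType d) (A : set W) :
  A !=set0 -> exists2 x, A x & forall y, A y -> x <= y.
Proof.
move=> [x]; elim: (lt_wf x) => {}x _ IH Ax.
have [[y yx Ay]|noty] := lem (exists2 y, y < x & A y); first exact: IH Ay.
by exists x => // y Ay; rewrite leNgt; apply/negP => yx; apply: noty; exists y.
Qed.

Section LexicographicProduct.
Context d d' (V : wellOrderType d) (W : wellOrderType d').

Lemma prodlexi_wf : well_founded (fun x y : V *l W => x < y).
Proof.
apply: (@wf_incl _ _ (slexprod V W <%O <%O)) => [[x1 x2] [y1 y2]|].
  rewrite Order.ProdLexiOrder.ltEprodlexi /=.
  case: (ltgtP x1 y1) => //= [xy _|-> xy]; first exact: left_slex.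
  exact: right_slex.
by apply: wf_slexprod; [exact: (@lt_wf _ V)|exact: (@lt_wf _ W)].
Qed.

HB.instance Definition _ := isWellFounded.Build (Order.lexi_display d d')
  (V *lexi[Order.lexi_display d d'] W)%type prodlexi_wf.

End LexicographicProduct.

Section Restriction.
Context d (W : wellOrderType d) (A : set W).

Lemma sub_type_wf : well_founded (fun x y : sub_type A => @Order.lt d _ x y).
Proof.
exact: (wf_inverse_image _ _ _ (val : sub_type A -> W) (@lt_wf d W)).
Qed.

HB.instance Definition _ := isWellFounded.Build d (sub_type A) sub_type_wf.

End Restriction.

Lemma well_order_total_order (T : eqType) (R : rel T) :
  well_order R -> total_order R.
Proof.
move=> Rwo; have Rch : wo_chain R predT by move=> A _; apply: Rwo.
have Rtot x y : R x y || R y x by apply: (wo_chainW Rch).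
have Ranti : antisymmetric R by move=> x y; apply: (wo_chain_antisymmetric Rch).
split=> //; split=> //; split=> [x|y x z Rxy Ryz].
  exact: (wo_chain_reflexive Rch).
have /Rwo[w [[/or3P[] /eqP-> wmin] _]] :
    wochoice.nonempty [pred u | [|| u == x, u == y | u == z]].
- by exists x; rewrite !inE eqxx.
- by apply: wmin; rewrite !inE eqxx !orbT.
- have -> : x = y by apply: Ranti; rewrite Rxy wmin // !inE eqxx.
  exact: Ryz.
- have <- : y = z by apply: Ranti; rewrite Ryz wmin // !inE eqxx orbT.
  exact: Rxy.
Qed.

Section OrderedBy.
Variables (T : choiceType) (R : rel T) (Rwo : well_order R).

Definition ordered_by & well_order R : Type := T.
Local Notation W := (ordered_by Rwo).

HB.instance Definition _ := Choice.copy W T.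

Let R_total_order : total_order R. Proof. exact: well_order_total_order. Qed.
Let R_anti : antisymmetric R. Proof. by case: R_total_order => [[]]. Qed.
Let R_trans : transitive R. Proof. by case: R_total_order => [[[]]]. Qed.
Let R_total : total R. Proof. by case: R_total_order. Qed.

HB.instance Definition _ := Order.isOrder.Build (Order.Disp tt tt) W
  (fun _ _ => erefl) (fun _ _ => erefl) (fun _ _ => erefl)
  R_anti R_trans R_total.

Let ordered_by_wf : well_founded (fun x y : W => x < y).
Proof.
move=> x; apply: contrapT => nacc.
pose bad := [pred z : T | `[< ~ Acc (fun x y : W => x < y) z >]].
have [|z [[/asboolP zP zmin] _]] := Rwo (A := bad).
  by exists x; apply/asboolP.
apply: zP; constructor => y yz; apply: contrapT => yP.
have zy : z <= y :> W by apply: zmin; apply/asboolP.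
by rewrite ltNge zy in yz.
Qed.

HB.instance Definition _ :=
  isWellFounded.Build (Order.Disp tt tt) W ordered_by_wf.

End OrderedBy.

Lemma Pwellorder : canonical Type (wellOrderType (Order.Disp tt tt)).
Proof.
apply: canon => T; have [R Rwo] := well_ordering_principle {classic T}.
by exists (ordered_by Rwo).
Qed.

(** * Cardinal arithmetic *)

Lemma wf_recursive_choice (Z U : Type) (u0 : U) (R : Z -> Z -> Prop)
    (P : Z -> (Z -> U) -> U -> Prop) :
  well_founded R ->
  (forall z f f' u, (forall y, R y z -> f y = f' y) -> P z f u -> P z f' u) ->
  (forall z f, exists u, P z f u) ->
  exists g, forall z, P z g (g z).
Proof.
move=> Rwf Plocal exP; pose next z f := projT1 (cid (exP z f)).
have nextP z f : P z f (next z f) by exact: projT2 (cid (exP z f)).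
pose extend z (f : forall y, R y z -> U) y :=
  if pselect (R y z) is left yz then f y yz else u0.
pose step z f := next z (extend z f).
pose g := Fix Rwf _ step; exists g => z.
have gE : g z = step z (fun y _ => g y).
  rewrite /g Fix_eq // => x f f' ff'; congr step.
  by apply: functional_extensionality_dep => y; apply/funext => yx.
rewrite gE; apply: Plocal (nextP z _) => y yz.
by rewrite /extend; case: pselect.
Qed.

Lemma card_le_rel T U (A : set T) (B : set U) (R : T -> U -> Prop) :
  (forall x, A x -> exists2 y, B y & R x y) ->
  (forall x x' y, A x -> A x' -> R x y -> R x' y -> x = x') -> A #<= B.
Proof.
elim/Ppointed: U => U in B R *.
  move=> AR _; rewrite !emptyE -subset0 => x /AR[y].
  by have := empty_eq0 B => ->.
move=> AR Rinj.
have /choice[f fP] : forall x, exists y, A x -> B y /\ R x y.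
  by move=> x; have [/AR[y]|] := lem (A x); [exists y|exists point].
apply/pcard_leP/injfunPex; exists f => [x /fP[]//|x x'].
move=> /set_mem Ax /set_mem Ax' fxx'; have [_ Rx] := fP x Ax.
by have [_] := fP x' Ax'; rewrite -fxx'; apply: Rinj.
Qed.

Lemma greedy_coloring (Z : Type) (U : pointedType) (R : Z -> Z -> Prop)
    (E : set Z) (B : set U) :
  well_founded R -> (forall z, E z -> ~ (B #<= E `&` [set y | R y z])) ->
  exists g, (forall z, E z -> B (g z)) /\
    forall y z, E y -> E z -> R y z -> g y <> g z.
Proof.
move=> Rwf Rsmall.
pose P z (f : Z -> U) u := E z -> B u /\ forall y, E y -> R y z -> f y <> u.
have [||g gP] := @wf_recursive_choice Z U point _ P Rwf; last first.
- by exists g; split=> [z /gP[]|y z Ey /gP[_ gz] yz]; [|exact: gz].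
- move=> z f; have [Ez|nEz] := lem (E z); last by exists point.
  apply: contrapT => /forallNP none; apply: (Rsmall z Ez).
  apply: (card_le_rel (R := fun u y => f y = u)) => [u Bu|u u' y _ _ <- <-//].
  apply: contrapT => nfu; apply: (none u) => _; split=> // y Ey yz fyu.
  by apply: nfu; exists y.
- move=> z f f' u ff' Pf Ez; have [Bu fu] := Pf Ez.
  by split=> // y Ey yz; rewrite -ff' //; apply: fu.
Qed.

Definition init_seg d (W : wellOrderType d) (w : W) : set W := [set y | y < w].

Lemma greedy_injection d (W : wellOrderType d) T (E : set W) (B : set T) :
  (forall w, E w -> ~ (B #<= E `&` init_seg w)) -> E #<= B.
Proof.
elim/Ppointed: T => T in B *.
  move=> Esmall; rewrite !emptyE -subset0 => w /Esmall.
  by rewrite emptyE.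
move=> /(greedy_coloring (@lt_wf _ W))[g [gB g_inj]].
apply/pcard_leP/injfunPex; exists g => // x y /set_mem Ex /set_mem Ey gxy.
by case: (ltgtP x y) => // lt_xy; case: (g_inj _ _ _ _ lt_xy).
Qed.

Lemma card_le_total T U (A : set T) (B : set U) : A #<= B \/ B #<= A.
Proof.
elim/Pwellorder: T => T in A *.
have [[x _ BA]|none] := lem (exists2 x, A x & B #<= A `&` init_seg x).
  by right; apply: card_le_trans BA (subset_card_le _) => y [].
by left; apply: greedy_injection => x Ax BA; apply: none; exists x.
Qed.

Lemma card_le_setU_disjoint T U (A B : set T) (A' B' : set U) :
  A `&` B = set0 -> A' `&` B' = set0 -> A #<= A' -> B #<= B' ->
  A `|` B #<= A' `|` B'.
Proof.
elim/Ppointed: U => U in A' B' *.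
  by rewrite !emptyE => _ _ -> ->; rewrite setU0.
move=> /disjoints_subset AB /disjoints_subset AB'.
move=> /pcard_leP/injfunPex[f fA f_inj] /pcard_leP/injfunPex[g gB g_inj].
apply: (card_le_rel (R := fun x y => (A x /\ y = f x) \/ (B x /\ y = g x))).
  move=> x [Ax|Bx]; [exists (f x)|exists (g x)].
  - by left; apply: fA.
  - by left.
  - by right; apply: gB.
  - by right.
move=> x x' y _ _ [[Ax ->]|[Bx ->]] [[Ax' e]|[Bx' e]].
- by apply: f_inj; rewrite ?inE.
- by case: (AB' (f x)); [exact: fA|rewrite e; exact: gB].
- by case: (AB' (f x')); [exact: fA|rewrite -e; exact: gB].
- by apply: g_inj; rewrite ?inE.
Qed.

Lemma card_setU1_infinite T (A : set T) x : infinite_set A -> x |` A #<= A.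
Proof.
elim/Ppointed: T => T in A x *; first by case: (no x).
move=> /infiniteP/pcard_leP/injfunPex[i iA i_inj].
have [Ax|nAx] := lem (A x); first by apply: subset_card_le => y [->|].
pose shift n := if n is S m then i m else x.
have AE : range i `|` (A `\` range i) = A.
  by apply: setDUK => _ [n _ <-]; apply: iA.
have range_shift : x |` range i = range shift.
  apply/seteqP; split=> [_ [->|[n _ <-]]|_ [[|n] _ <-]].
  - by exists 0.
  - by exists (S n).
  - by left.
  - by right; exists n.
rewrite -[in x |` A]AE -[X in _ #<= X]AE setUA.
apply: card_le_setU_disjoint => //; last first.
- have rangeE := inj_card_eq i_inj.
  by rewrite range_shift (card_le_eqr rangeE) card_image_le.
- by rewrite setDE setICA setICr setI0.
- by apply/disjoints_subset => y [->|iy] [].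
Qed.

Lemma card_le_setX T T' U U' (A : set T) (A' : set T')
    (B : set U) (B' : set U') :
  A #<= B -> A' #<= B' -> A `*` A' #<= B `*` B'.
Proof.
elim/Ppointed: U => U in B *; first by rewrite !emptyE => -> _; rewrite set0X.
elim/Ppointed: U' => U' in B' *.
  by rewrite !emptyE => _ ->; rewrite setX0.
move=> /pcard_leP/injfunPex[f fA f_inj] /pcard_leP/injfunPex[g gA' g_inj].
apply/pcard_leP/injfunPex; exists (fun p => (f p.1, g p.2)).
  by move=> [x y] [/= /fA Bx /gA' By].
move=> [x y] [x' y'] /set_mem[/= Ax Ay] /set_mem[/= Ax' Ay'] [ff gg].
by congr (_, _); [apply: f_inj|apply: g_inj]; rewrite ?inE.
Qed.

(* Goedel's well-ordering of pairs by their maximum, then lexicographically: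
   the predecessors of [p] lie in the square of the pairs bounded by [max p]. *)
Lemma card_setXX_of_init_seg d (W : wellOrderType d) (D : set W) :
  (forall x y, D y -> x < y -> D x) -> infinite_set D ->
  (forall w, D w -> infinite_set (init_seg w) ->
    init_seg w `*` init_seg w #<= init_seg w) ->
  D `*` D #<= D.
Proof.
move=> Ddown Dinf Dsq.
have [[w Dw Dle]|Dinit] := lem (exists2 w, D w & D #<= init_seg w).
  have winf : infinite_set (init_seg w) by move/(card_le_finite Dle).
  apply: (card_le_trans (card_le_setX Dle Dle)).
  apply: (card_le_trans (Dsq w Dw winf)).
  by apply: subset_card_le => x; apply: Ddown.
pose goedel (p : W * W) := (Order.max p.1 p.2, p) : W *l (W *l W)%type.
have goedel_inj : {in D `*` D &, injective goedel} by move=> p q _ _ [].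
rewrite -(card_le_eql (inj_card_eq goedel_inj)).
apply: greedy_injection => _ [p [Dp1 Dp2] <-] Dle.
pose m := Order.max p.1 p.2; pose below := m |` init_seg m.
have Dm : D m by rewrite /m; case: leP.
have Dle_below : D #<= below `*` below.
  apply: (card_le_trans Dle); apply: (card_le_trans _ (card_image_le goedel _)).
  apply: subset_card_le => _ [[q _ <-] qp]; exists q => //.
  move: qp; rewrite /init_seg /= Order.ProdLexiOrder.ltEprodlexi.
  move=> /andP[/= qm _].
  have below_le y : y <= m -> below y.
    by rewrite le_eqVlt => /orP[/eqP|]; [left|right].
  move: qm; rewrite ge_max => /andP[q1 q2].
  by split; apply: below_le.
have [fin|inf] := lem (finite_set (init_seg m)).
  apply: Dinf; apply: card_le_finite Dle_below _.
  by apply: finite_setX; rewrite finite_setU; split.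
apply: Dinit; exists m => //; apply: (card_le_trans Dle_below).
apply: card_le_trans (Dsq m Dm inf).
by apply: card_le_setX; apply: card_setU1_infinite.
Qed.

Lemma card_setXX_infinite T (M : set T) : infinite_set M -> M `*` M #<= M.
Proof.
move=> Minf; have [S SM] : exists S : Type, [set: S] #= M by exists M.
have /card_eqPle[leSM leMS] := SM.
have Sinf : infinite_set [set: S] by rewrite (eq_finite_set SM).
apply: (card_le_trans (card_le_setX leMS leMS)); apply: card_le_trans leSM.
clear -Sinf; elim/Pwellorder: S => S in Sinf *.
apply: card_setXX_of_init_seg => // w _; elim: (lt_wf w) => {}w _ IH winf.
by apply: card_setXX_of_init_seg => // x y yw xy; apply: lt_trans yw.
Qed.

Lemma card_le_bigcup I T U (D : set I) (F : I -> set T) (M : set U) :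
  infinite_set M -> D #<= M -> (forall i, D i -> F i #<= M) ->
  \bigcup_(i in D) F i #<= M.
Proof.
elim/Ppointed: U => U in M *; first by move=> [].
move=> Minf /pcard_leP/injfunPex[s sM s_inj] leFM.
have /choice[t tP] : forall i, exists t : T -> U,
    D i -> set_fun (F i) M t /\ set_inj (F i) t.
  move=> i; have [Di|nDi] := lem (D i); last by exists (fun=> point).
  by have /pcard_leP/injfunPex[t tM t_inj] := leFM i Di; exists t.
apply: card_le_trans (card_setXX_infinite Minf).
apply: (card_le_rel
  (R := fun x p => exists i, [/\ D i, F i x & p = (s i, t i x)])).
  move=> x [i Di Fix]; exists (s i, t i x); last by exists i.
  by split; [exact: sM|exact: (tP i Di).1].
move=> x y _ _ _ [i [Di Fix ->]] [j [Dj Fjy [sij tij]]].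
have eij : i = j by apply: s_inj; rewrite ?inE.
by move: Fjy tij; rewrite -eij => Fiy; apply: (tP i Di).2; rewrite inE.
Qed.

Lemma countable_card_le T U (A : set T) (M : set U) :
  countable A -> infinite_set M -> A #<= M.
Proof. by move=> Acount /infiniteP; apply: card_le_trans. Qed.

Lemma card_le_setU T U (A B : set T) (M : set U) :
  infinite_set M -> A #<= M -> B #<= M -> A `|` B #<= M.
Proof.
move=> Minf leAM leBM; rewrite -bigcup2E.
apply: card_le_bigcup => // [|[|[|n]] _ //=].
exact: countable_card_le.
Qed.

Lemma card_list_infinite T :
  infinite_set [set: T] -> [set: list T] #<= [set: T].
Proof.
move=> Tinf.
have length_le n : [set s : list T | length s = n] #<= [set: T].
  elim: n => [|n IH].
    apply: countable_card_le Tinf.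
    apply: (card_le_trans _ (countable1 (@nil T))).
    by apply: subset_card_le => s /length_zero_iff_nil.
  apply: (card_le_trans _ (card_setXX_infinite Tinf)).
  apply: (card_le_trans _ (card_le_setX (card_lexx _) IH)).
  apply: (card_le_rel (R := fun s p => s = p.1 :: p.2)); last first.
    by move=> s s' p _ _ -> ->.
  by move=> [|x s] //= [sn]; exists (x, s).
have -> : [set: list T] = \bigcup_n [set s | length s = n].
  by apply/seteqP; split=> // s _; exists (length s).
by apply: card_le_bigcup => //; apply: countable_card_le.
Qed.

(** * Successor cardinals *)

Record successor_order (M : Type) d (W : wellOrderType d) : Prop := {
  succ_infinite : infinite_set [set: M];
  succ_init_seg : forall w : W, init_seg w #<= [set: M];
  succ_large : ~ ([set: W] #<= [set: M]) }.

Lemma successor_order_exists (M Z : Type) :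
  infinite_set [set: M] -> ~ ([set: Z] #<= [set: M]) ->
  exists W : wellOrderType (Order.Disp tt tt),
    successor_order M W /\ [set: W] #<= [set: Z].
Proof.
elim/Pwellorder: Z => Z Minf Zlarge.
pose D := [set z : Z | init_seg z #<= [set: M]].
have DE : [set: sub_type D] #= D by exact: card_setT.
exists (sub_type D); split; last by rewrite (card_le_eql DE) card_leT.
split=> // [w|].
  have w_init : init_seg (val w) #<= [set: M] by exact: set_mem (valP w).
  apply: card_le_trans w_init.
  rewrite -(card_le_eql (@inj_card_eq _ _ (init_seg w) val _)); last first.
    by move=> x y _ _; apply: val_inj.
  by apply: subset_card_le => _ [x xw <-].
rewrite (card_le_eql DE) => DM.
have [z0 nDz0] : (~` D) !=set0.
  apply: contrapT => /nonemptyPn; rewrite -setCT => /setC_inj DT.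
  by apply: Zlarge; rewrite -DT.
have [z nDz zmin] := ex_minimum (ex_intro _ z0 nDz0).
apply: nDz; apply: card_le_trans DM; apply: subset_card_le => y yz.
by apply: contrapT => /zmin; rewrite leNgt yz.
Qed.

Section StrictSup.
Context d (W : wellOrderType d).
Implicit Types (A : set W) (x y : W).

Definition strict_sup A y :=
  (forall x, A x -> x < y) /\ forall x, x < y -> exists2 a, A a & x <= a.

Lemma strict_sup_unique A y y' : strict_sup A y -> strict_sup A y' -> y = y'.
Proof.
move=> [ub least] [ub' least']; case: (ltgtP y y') => // [yy'|y'y].
  by have [a /ub ay] := least' y yy'; rewrite leNgt ay.
by have [a /ub' ay'] := least y' y'y; rewrite leNgt ay'.
Qed.

Lemma strict_sup_of_bounded A w :
  (forall x, A x -> x < w) -> exists y, strict_sup A y.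
Proof.
move=> Aw; pose ub := [set y | forall x, A x -> x < y].
have [|y yub ymin] := @ex_minimum _ W ub; first by exists w.
exists y; split=> // x xy; apply: contrapT => none.
have /ymin : ub x.
  by move=> a Aa; rewrite ltNge; apply/negP => xa; apply: none; exists a.
by rewrite leNgt xy.
Qed.

Lemma cofinal_sequence_choice (I : Type) :
  exists c : W -> I -> W, forall y,
    (exists f : I -> W, strict_sup (range f) y) -> strict_sup (range (c y)) y.
Proof.
suff /choice[c cP] : forall y, exists c : I -> W,
    (exists f : I -> W, strict_sup (range f) y) -> strict_sup (range c) y.
  by exists c.
move=> y.
have [[f fP]|none] := lem (exists f : I -> W, strict_sup (range f) y).
  by exists f.
by exists (fun=> y).
Qed.

End StrictSup.

Section SuccessorOrder.
Context (M : Type) d (W : wellOrderType d) (sW : successor_order M W).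

Lemma successor_card_le_of_bounded (A : set W) w :
  (forall x, A x -> x <= w) -> A #<= [set: M].
Proof.
move=> Aw; have AE : A `<=` w |` init_seg w.
  by move=> x /Aw; rewrite le_eqVlt => /orP[/eqP|]; [left|right].
apply: (card_le_trans (subset_card_le AE)).
apply: (card_le_setU (succ_infinite sW)) (succ_init_seg sW w).
exact: countable_card_le (countable1 w) (succ_infinite sW).
Qed.

Lemma successor_bounded (A : set W) :
  A #<= [set: M] -> exists w, forall x, A x -> x < w.
Proof.
move=> AM; apply: contrapT => unb; apply: (succ_large sW).
have -> : [set: W] = \bigcup_(x in A) [set w | w <= x].
  apply/seteqP; split=> // w _; apply: contrapT => nw; apply: unb.
  by exists w => x Ax; rewrite ltNge; apply/negP => wx; apply: nw; exists x.
apply: (card_le_bigcup (succ_infinite sW) AM) => x _.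
exact: (@successor_card_le_of_bounded _ x).
Qed.

Lemma successor_strict_sup (A : set W) :
  A #<= [set: M] -> exists y, strict_sup A y.
Proof. by move=> /successor_bounded[w]; apply: strict_sup_of_bounded. Qed.

Lemma successor_nonempty : [set: W] !=set0.
Proof. by have [w _] := successor_bounded (card_ge0 _ _); exists w. Qed.

Lemma successor_gt (x : W) : exists y, x < y.
Proof.
have [|y xy] := @successor_bounded [set x]; last by exists y; apply: xy.
exact: countable_card_le (countable1 x) (succ_infinite sW).
Qed.

Lemma successor_ge_base : [set: M] #<= [set: W].
Proof. by have [|/(succ_large sW)] := card_le_total [set: M] [set: W]. Qed.

Lemma successor_infinite : infinite_set [set: W].
Proof.
move=> Wfin; apply: (succ_infinite sW).
exact: card_le_finite successor_ge_base Wfin.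
Qed.

Lemma successor_dichotomy T (A : set T) : [set: W] #<= A \/ A #<= [set: M].
Proof.
have [[w AW]|small] := lem (exists w : W, A #<= init_seg w).
  by right; apply: card_le_trans AW (succ_init_seg sW w).
left; apply: greedy_injection => w _; rewrite setTI => Aw.
by apply: small; exists w.
Qed.

Lemma successor_dominated (F : set (W -> W)) :
  F #<= [set: M] -> exists v, forall f x, F f -> f x < v x.
Proof.
move=> FM; suff /choice[v vP] : forall x, exists y, forall f, F f -> f x < y.
  by exists v => f x; apply: vP.
move=> x; have [|y yP] := @successor_bounded [set f x | f in F].
  exact: card_le_trans (card_image_le _ _) FM.
by exists y => f Ff; apply: yP; exists f.
Qed.

Lemma increasing_sequence_in d' (I : wellOrderType d') (P : set W) :
  (forall i : I, init_seg i #<= [set: M]) ->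
  (forall x, exists2 y, P y & x < y) ->
  exists2 z : I -> W, forall i, P (z i) & {homo z : i j / i < j}.
Proof.
move=> initM Punb; have [w0 _] := successor_nonempty.
pose next i (f : I -> W) v := P v /\ forall j, j < i -> f j < v.
have [||z zP] := @wf_recursive_choice I W w0 _ next (@lt_wf _ I).
- by move=> i f f' v ff' [Pv fv]; split=> // j ji; rewrite -ff' // fv.
- move=> i f; have [|w wP] := @successor_bounded (f @` init_seg i).
    exact: card_le_trans (card_image_le _ _) (initM i).
  have [v Pv wv] := Punb w; exists v; split=> // j ji.
  by apply: lt_trans wv; apply: wP; exists j.
by exists z => [i|i j]; [have [] := zP i|have [_] := zP j; apply].
Qed.

Lemma dominating_chain d' (I : wellOrderType d') (next : (W -> W) -> W -> W) :
  (forall i : I, init_seg i #<= [set: M]) ->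
  exists ks : I -> W -> W, forall i j x, i < j ->
    ks i x < ks j x /\ next (ks i) x < ks j x.
Proof.
move=> initM.
pose dominates j (f : I -> W -> W) v :=
  forall i x, i < j -> f i x < v x /\ next (f i) x < v x.
have [||ks ksP] := @wf_recursive_choice I (W -> W) id _ dominates (@lt_wf _ I).
- by move=> j f f' v ff' vP i x ij; rewrite -ff' //; apply: vP.
- move=> j f; pose F := f @` init_seg j.
  have FM : F #<= [set: M] := card_le_trans (card_image_le _ _) (initM j).
  have [|v vP] := @successor_dominated (F `|` next @` F).
    apply: (card_le_setU (succ_infinite sW)) => //.
    exact: card_le_trans (card_image_le _ _) FM.
  exists v => i x ij; have Ff : F (f i) by exists i.
  by split; apply: vP; [left|right; exists (f i)].
by exists ks => i j; apply: ksP.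
Qed.

End SuccessorOrder.

(** * Club guessing *)

Section ClosurePoints.
Context d (W : wellOrderType d).
Implicit Types (k : W -> W) (x i : W).

(* Every closed unbounded subset of a successor cardinal contains the closure
   points of some function, so functions stand for clubs throughout. *)
Definition closure_points k : set W := [set i | forall j, j < i -> k j < i].

Lemma closure_points_anti k k' :
  (forall x, k x <= k' x) -> closure_points k' `<=` closure_points k.
Proof. by move=> kk' i ci j /ci; apply: le_lt_trans. Qed.

Definition closure_floor k x : W :=
  xget x [set i | [/\ closure_points k i, i <= x &
                      forall j, closure_points k j -> j <= x -> j <= i]].

Lemma closure_floorP k x :
  [/\ closure_points k (closure_floor k x), closure_floor k x <= x &
      forall j, closure_points k j -> j <= x -> j <= closure_floor k x].
Proof.
rewrite /closure_floor; case: xgetP => // none.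
pose ub := [set y : W | forall j, closure_points k j -> j <= x -> j <= y].
have [|y yub ymin] := @ex_minimum _ W ub; first by exists x.
case: (none y); split=> //; last by apply: ymin.
move=> j jy; rewrite ltNge; apply/negP => ykj.
have /ymin : ub j; last by rewrite leNgt jy.
move=> i ci ix; rewrite leNgt; apply/negP => ji.
by move: ykj; rewrite leNgt (lt_le_trans (ci j ji)) // yub.
Qed.

Lemma closure_floor_anti k k' x :
  (forall y, k y <= k' y) -> closure_floor k' x <= closure_floor k x.
Proof.
move=> kk'; have [c' le' _] := closure_floorP k' x.
have [_ _] := closure_floorP k x; apply=> //; exact: closure_points_anti c'.
Qed.

End ClosurePoints.

Lemma closure_points_unbounded (M : Type) d (W : wellOrderType d) k (x : W) :
  successor_order M W -> exists2 i, closure_points k i & x < i.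
Proof.
move=> sW.
have /choice[next nextP] :
    forall y : W, exists z, y < z /\ forall j, j < y -> k j < z.
  move=> y; have [|w wP] := @successor_bounded _ _ _ sW (k @` init_seg y).
    exact: card_le_trans (card_image_le _ _) (succ_init_seg sW y).
  have [z] := successor_gt sW (Order.max y w); rewrite gt_max => /andP[yz wz].
  by exists z; split=> // j jy; apply: lt_trans wz; apply: wP; exists j.
pose orbit n := Nat.iter n next x.
have [|i [ub least]] := @successor_strict_sup _ _ _ sW (range orbit).
  by apply: countable_card_le (succ_infinite sW); apply: card_image_le.
exists i; last by apply: ub; exists 0.
move=> j /least[_ [n _ <-] jn]; apply: (@lt_trans _ _ (orbit (S (S n)))).
  by apply: (proj2 (nextP _)); apply: le_lt_trans jn (nextP _).1.
by apply: ub; exists (S (S n)).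
Qed.

Lemma antitone_eventually_constant (J : Type) d (I : wellOrderType d)
    d' (W : wellOrderType d') (f : J -> I -> W) :
  successor_order J I -> (forall j i i', i < i' -> f j i' <= f j i) ->
  exists i, forall j i', i < i' -> f j i' = f j i.
Proof.
move=> sI fanti; have [i0 _] := successor_nonempty sI.
have /choice[s sP] : forall j, exists s, forall i, s < i -> f j i = f j s.
  move=> j; have [|_ [s _ <-] smin] := @ex_minimum _ W (range (f j)).
    by exists (f j i0), i0.
  exists s => i si; apply/eqP; rewrite eq_le fanti //=.
  by apply: smin; exists i.
have [|i iP] := @successor_bounded _ _ _ sI (range s).
  exact: card_image_le.
exists i => j i' ii'; have si : s j < i by apply: iP; exists j.
by rewrite !(sP j) //; apply: lt_trans ii'.
Qed.

Lemma floor_ladder_large (M : Type) d (I : wellOrderType d)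
    d' (W : wellOrderType d') (k : W -> W) (z c : I -> W) a :
  successor_order M I -> (forall i, closure_points k (z i)) ->
  {homo z : i j / i < j} -> strict_sup (range z) a -> strict_sup (range c) a ->
  ~ (range (closure_floor k \o c) #<= [set: M]).
Proof.
move=> sI zk z_incr [zub zcof] [cub ccof] CM.
pose C := range (closure_floor k \o c).
have /choice[b bP] : forall x, exists i, C x -> x <= z i.
  move=> x; have [[j _ <-]|nCx] := lem (C x); last first.
    by have [i _] := successor_nonempty sI; exists i.
  have [_ floor_le _] := closure_floorP k (c j).
  have [|_ [i _ <-] le_z] := zcof (closure_floor k (c j)); last by exists i.
  by apply: le_lt_trans floor_le _; apply: cub; exists j.
have [|j jP] := @successor_bounded _ _ _ sI (b @` C).
  exact: card_le_trans (card_image_le _ _) CM.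
have [|_ [i _ <-] zc] := ccof (z j); first by apply: zub; exists j.
have Ci : C (closure_floor k (c i)) by exists i.
have [_ _ /(_ (z j) (zk j) zc)] := closure_floorP k (c i).
rewrite leNgt => /negP; apply; apply: le_lt_trans (bP _ Ci) _.
by apply: z_incr; apply: jP; exists (closure_floor k (c i)).
Qed.

(* Shelah's argument: the guess at [a] is a ladder of [a] rounded down to
   closure points of some [k].  If no [k] worked, iterating "dominate a function
   refuting the guesses made so far" along [W2] would make all roundings
   decrease, hence stabilise, so that the refuted guesses were correct. *)
Lemma club_guessing (M : Type) d1 d2 d3 (W1 : wellOrderType d1)
    (W2 : wellOrderType d2) (W3 : wellOrderType d3) :
  successor_order M W1 -> successor_order W1 W2 -> successor_order W2 W3 ->
  exists C : W3 -> set W3, forall k : W3 -> W3, exists a,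
    ~ (C a #<= [set: M]) /\ C a `<=` closure_points k.
Proof.
move=> s1 s2 s3; have [c cP] := cofinal_sequence_choice W3 W1.
pose guess k a := range (closure_floor k \o c a).
apply: contrapT => fails.
have /choice[refute refuteP] : forall k, exists k', forall a,
    ~ (guess k a #<= [set: M]) -> ~ guess k a `<=` closure_points k'.
  move=> k; apply: contrapT => /forallNP none; apply: fails.
  exists (guess k) => k'; apply: contrapT => /forallNP none'.
  by apply: (none k') => a large sub; apply: (none' a).
have [ks ksP] :=
  dominating_chain s3 refute (fun i : W2 => card_leT (init_seg i)).
have [|kmax kmaxP] := successor_dominated s3 (F := range ks).
  exact: card_image_le.
have init1 (i : W1) : init_seg i #<= [set: W2].
  exact: card_le_trans (card_leT _) (successor_ge_base s2).
have [|z z_closed z_incr] :=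
    increasing_sequence_in s3 (P := closure_points kmax) init1.
  by move=> x; exact: closure_points_unbounded s3.
have [|a zsup] := @successor_strict_sup _ _ _ s3 (range z).
  exact: card_le_trans (card_image_le _ _) (successor_ge_base s2).
have csup : strict_sup (range (c a)) a by apply: cP; exists z.
have [|i iP] := @antitone_eventually_constant W1 _ W2 _ W3
    (fun j i => closure_floor (ks i) (c a j)) s2.
  move=> j i i' ii'; apply: closure_floor_anti => x.
  by apply/ltW; apply: (ksP _ _ x ii').1.
apply: (refuteP (ks i) a).
  apply: (floor_ladder_large s1 _ z_incr zsup csup) => j.
  by apply: closure_points_anti (z_closed j) => x; apply/ltW/kmaxP; exists i.
have [i' ii'] := successor_gt s2 i.
move=> _ [j _ <-] /=; rewrite -(iP j i' ii').
have [] := closure_floorP (ks i') (c a j) => + _ _.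
by apply: closure_points_anti => x; apply/ltW; apply: (ksP _ _ x ii').2.
Qed.

(** * Singular cardinals *)

Lemma card_le_typeP (T U : Type) : Defs.card_le T U <-> [set: T] #<= [set: U].
Proof.
split=> [[f f_inj]|].
  apply: (card_le_rel (R := fun x y => y = f x)); last first.
    by move=> x x' _ _ _ -> /f_inj.
  by move=> x _; exists (f x).
elim/Ppointed: U => U; last first.
  by move=> /pcard_injP[f f_inj]; exists f => x y; apply: f_inj; rewrite inE.
rewrite !emptyE => T0; have noT (x : T) : False.
  by rewrite -[False]/(set0 x) -T0.
by exists (fun x => False_rect U (noT x)) => x; case: (noT x).
Qed.

Lemma card_eq_typeP (T U : Type) : Defs.card_eq T U <-> [set: T] #= [set: U].
Proof.
split=> [[f [g [fK gK]]]|].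
  apply/card_eqPle; split; apply/card_le_typeP.
    by exists f; apply: can_inj fK.
  by exists g; apply: can_inj gK.
elim/Ppointed: U => U.
  rewrite !emptyE => T0; have noT (x : T) : False.
    by rewrite -[False]/(set0 x) -T0.
  exists (fun x => False_rect U (noT x)), (fun y => False_rect T (no y)).
  by split=> x; [case: (noT x)|case: (no x)].
by move=> /pcard_eqP[f]; have [g fK gK] : bijective f := bijTT; exists f, g.
Qed.

Lemma card_sig T (P : T -> Prop) : [set: {x | P x}] #= [set x | P x].
Proof.
have val_inj : {in [set: {x | P x}] &, injective (@proj1_sig T P)}.
  move=> [x Px] [y Py] _ _ /= xy; subst y; congr exist; exact: Prop_irrelevance.
rewrite card_eq_sym; have <- : range (@proj1_sig T P) = [set x | P x].
  by apply/seteqP; split=> [_ [[x Px] _ <-]|x Px] //; exists (exist _ x Px).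
exact: inj_card_eq.
Qed.

Lemma singular_countable_cofE (L : Type) : singular_countable_cof L ->
  ~ countable [set: L] /\ exists A : nat -> set L,
    (forall x, exists n, A n x) /\ forall n, ~ ([set: L] #<= A n).
Proof.
move=> [Lunc [A [Acov Asmall]]]; split; first by move=> /card_le_typeP.
exists A; split=> // n LA; have [_] := Asmall n; apply; apply/card_le_typeP.
by rewrite (card_le_eqr (card_sig _)).
Qed.

Lemma successor_card_order (L K : Type) :
  infinite_set [set: L] -> is_successor_card L K ->
  exists W : wellOrderType (Order.Disp tt tt),
    successor_order L W /\ [set: W] #= [set: K].
Proof.
move=> Linf [[_ KL] dich].
have [|W [sW WK]] := successor_order_exists (Z := K) Linf.
  by move=> /card_le_typeP.
exists W; split=> //; apply/card_eqPle; split=> //.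
have /card_subP[Y YW _] := WK.
rewrite -(card_le_eqr YW) -(card_le_eqr (card_sig Y)).
case: (dich Y) => /card_le_typeP //.
by rewrite (card_le_eql (card_sig Y)) (card_le_eql YW) => /(succ_large sW).
Qed.

Section Singular.
Context (L : Type) (singL : singular_countable_cof L).

Lemma singular_not_successor M d (W : wellOrderType d) :
  successor_order M W -> ~ ([set: L] #<= [set: M]) -> ~ ([set: L] #<= [set: W]).
Proof.
have [_ [A [Acov Asmall]]] := singular_countable_cofE singL.
move=> sW LM LW; apply: LM.
have -> : [set: L] = \bigcup_n A n.
  by apply/seteqP; split=> // x _; have [n Anx] := Acov x; exists n.
have Minf := succ_infinite sW.
apply: (card_le_bigcup Minf) => [|n _]; first exact: countable_card_le.
have [WA|//] := successor_dichotomy sW (A n).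
by case: (Asmall n); apply: card_le_trans LW WA.
Qed.

Lemma singular_successor M :
  infinite_set [set: M] -> ~ ([set: L] #<= [set: M]) ->
  exists W : wellOrderType (Order.Disp tt tt),
    [/\ successor_order M W, [set: W] #<= [set: L] & ~ ([set: L] #<= [set: W])].
Proof.
move=> Minf LM; have [W [sW WL]] := successor_order_exists Minf LM.
by exists W; split=> //; apply: singular_not_successor sW LM.
Qed.

End Singular.

Lemma not_card_le_setU T U (A B : set T) (M : set U) : infinite_set M ->
  ~ (M #<= A) -> ~ (M #<= B) -> ~ (M #<= A `|` B).
Proof.
move=> Minf; wlog AB : A B / A #<= B => [wl|] MA MB MAB.
  have [AB|BA] := card_le_total A B; first exact: (wl A B AB MA MB MAB).
  by apply: (wl B A BA MB MA); rewrite setUC.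
have [Bfin|Binf] := lem (finite_set B).
  apply: Minf; apply: card_le_finite MAB _.
  by rewrite finite_setU; split=> //; apply: card_le_finite AB Bfin.
by apply: MB; apply: card_le_trans MAB _; apply: card_le_setU.
Qed.

Lemma singular_filtration (L M : Type) : singular_countable_cof L ->
  infinite_set [set: M] -> [set: M] #<= [set: L] -> ~ ([set: L] #<= [set: M]) ->
  exists D : nat -> set L,
    [/\ forall m n, (m <= n)%nat -> D m `<=` D n, forall x, exists n, D n x,
        forall n, [set: M] #<= D n & forall n, ~ ([set: L] #<= D n)].
Proof.
move=> singL Minf /card_subP[R RM _] LM.
have [Lunc [A [Acov Asmall]]] := singular_countable_cofE singL.
have Linf := contra_not (@finite_set_countable _ _) Lunc.
(* A copy [R] of [M] is put into every member. *)
pose D := fix D n := if n is S m then D m `|` A m else R.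
have DS n : D n `<=` D (S n) by move=> x; left.
have D_mono m n : (m <= n)%nat -> D m `<=` D n.
  by elim=> [//|{}n _ IH]; apply: subset_trans IH (DS n).
exists D; split=> //.
- by move=> x; have [n Anx] := Acov x; exists (S n); right.
- move=> n; have /card_eqPle[_ MR] := RM.
  by apply: card_le_trans MR (subset_card_le _); apply: (D_mono 0); lia.
- elim=> [|n IH]; last exact: not_card_le_setU.
  by rewrite (card_le_eqr RM).
Qed.

Lemma clos_trans_card_le T U (R : T -> T -> Prop) (M : set U) :
  well_founded R -> infinite_set M -> (forall y, [set x | R x y] #<= M) ->
  forall y, [set x | clos_trans T R x y] #<= M.
Proof.
move=> Rwf Minf RM y; elim: (Rwf y) => {}y _ IH.
have last_step : [set x | clos_trans T R x y] `<=`
    [set x | R x y] `|`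
      \bigcup_(z in [set z | R z y]) [set x | clos_trans T R x z].
  move=> x /clos_trans_tn1_iff; case=> [|z w zw /clos_trans_tn1_iff xz].
    by left.
  by right; exists z.
apply: (card_le_trans (subset_card_le last_step)).
by apply: card_le_setU => //; apply: card_le_bigcup.
Qed.

(** * Filtrations of a well-order *)

Record order_filtration d (K : wellOrderType d)
    (G : nat -> K -> K -> Prop) : Prop := {
  filtration_lt : forall n x y, G n x y -> x < y;
  filtration_trans : forall n x y z, G n x y -> G n y z -> G n x z;
  filtration_mono : forall m n x y, (m <= n)%nat -> G m x y -> G n x y;
  filtration_cover : forall x y, x < y -> exists n, G n x y }.

Definition catches_limits d d' (W : wellOrderType d) (K : wellOrderType d')
    (R : K -> K -> Prop) :=
  forall (xi : W -> K) a, {homo xi : i j / i < j} -> strict_sup (range xi) a ->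
  exists k, forall i y,
    closure_points k i -> strict_sup (xi @` init_seg i) y -> R y a.

Lemma partial_sup_agree d d' (W : wellOrderType d) (K : wellOrderType d')
    (xi xi' : W -> K) a :
  (forall i : W, exists j, i < j) ->
  strict_sup (range xi) a -> strict_sup (range xi') a ->
  exists k, forall i y, closure_points k i ->
    strict_sup (xi @` init_seg i) y -> strict_sup (xi' @` init_seg i) y.
Proof.
move=> nomax [ub cof] [ub' cof'].
have /choice[k kP] : forall j, exists m,
    (exists2 i, i < m & xi j <= xi' i) /\ (exists2 i, i < m & xi' j <= xi i).
  move=> j; have xi_a : xi j < a by apply: ub; exists j.
  have xi'_a : xi' j < a by apply: ub'; exists j.
  have [_ [i _ <-] le_i] := cof' _ xi_a.
  have [_ [i' _ <-] le_i'] := cof _ xi'_a.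
  have [m] := nomax (Order.max i i'); rewrite gt_max => /andP[im i'm].
  by exists m; split; [exists i|exists i'].
exists k => i y ci [uby leasty].
split=> [_ [j ji <-]|x /leasty[_ [j ji <-] xj]].
  have [_ [m mk jm]] := kP j; apply: le_lt_trans jm _; apply: uby.
  by exists m => //; apply: lt_trans mk (ci j ji).
have [[m mk jm] _] := kP j; exists (xi' m); last exact: le_trans jm.
by exists m => //; apply: lt_trans mk (ci j ji).
Qed.

(* [code a] injects the points below [a] into [L], and [c a] is a chosen
   [W]-sequence cofinal in [a]: at stage [n], [a] sees the points coded in
   [D n] and all limits of its own sequence. *)
Section Approximation.
Context (L : Type) d d' (W : wellOrderType d) (K : wellOrderType d').
Context (D : nat -> set L) (code : K -> K -> L) (c : K -> W -> K).
Hypotheses (D_mono : forall m n, (m <= n)%nat -> D m `<=` D n)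
  (D_cover : forall x, exists n, D n x) (W_le_D : forall n, [set: W] #<= D n)
  (W_infinite : infinite_set [set: W]) (W_nomax : forall i : W, exists j, i < j)
  (code_inj : forall a, {in init_seg a &, injective (code a)})
  (c_cofinal : forall a, (exists f : W -> K, strict_sup (range f) a) ->
     strict_sup (range (c a)) a).

Definition visible n b a := b < a /\
  (D n (code a b) \/ exists i, strict_sup (c a @` init_seg i) b).

Definition approximation n := clos_trans K (visible n).

Lemma approximation_filtration : order_filtration approximation.
Proof.
split=> [n x y|n x y z|m n x y mn|x y xy]; last 1 first.
- have [n Dn] := D_cover (code y x); exists n; apply: t_step.
  by split=> //; left.
- by elim=> [{}x {}y []|{}x {}y z _ xy _ yz] //; apply: lt_trans yz.
- exact: t_trans.
- elim=> [{}x {}y [xy sees]|{}x {}y z _ xy _]; last exact: t_trans.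
  apply: t_step; split=> //; case: sees => [Dm|]; [left|by right].
  exact: D_mono Dm.
Qed.

Lemma approximation_card_le n a : [set b | approximation n b a] #<= D n.
Proof.
have Dinf : infinite_set (D n).
  by move=> Dfin; apply: W_infinite; apply: card_le_finite Dfin.
have visible_wf : well_founded (visible n).
  by apply: (wf_incl _ _ _ _ (@lt_wf _ K)) => x y [].
apply: (clos_trans_card_le visible_wf Dinf) => {}a.
pose coded := [set b | b < a /\ D n (code a b)].
pose limits := [set b | exists i, strict_sup (c a @` init_seg i) b].
apply: (card_le_trans (B := coded `|` limits)).
  by apply: subset_card_le => b [ba [Dn|lim]]; [left|right].
apply: card_le_setU => //.
  apply: (card_le_rel (R := fun b x => x = code a b)).
    by move=> b []; exists (code a b).
  by move=> b b' _ [ba _] [b'a _] ->; apply: code_inj; rewrite inE.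
apply: card_le_trans (W_le_D n).
apply: (card_le_rel (R := fun b i => strict_sup (c a @` init_seg i) b)).
  by move=> b [i]; exists i.
by move=> b b' i _ _; apply: strict_sup_unique.
Qed.

Lemma approximation_catches_limits n : catches_limits W (approximation n).
Proof.
move=> xi a xi_incr xi_sup.
have c_sup : strict_sup (range (c a)) a by apply: c_cofinal; exists xi.
have [k kP] := partial_sup_agree W_nomax xi_sup c_sup.
exists k => i y ci supy; apply: t_step.
split; last by right; exists i; apply: kP.
have xi_a : xi i < a by apply: (proj1 xi_sup); exists i.
apply: le_lt_trans xi_a; rewrite leNgt; apply/negP.
move=> /(proj2 supy)[_ [j ji <-]].
by rewrite leNgt xi_incr.
Qed.

End Approximation.

Lemma small_order_filtration (L : Type) d d' (W : wellOrderType d)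
    (K : wellOrderType d') :
  singular_countable_cof L -> successor_order L K -> infinite_set [set: W] ->
  (forall i : W, exists j, i < j) ->
  [set: W] #<= [set: L] -> ~ ([set: L] #<= [set: W]) ->
  exists G : nat -> K -> K -> Prop, [/\ order_filtration G,
    forall n a, ~ ([set: L] #<= [set b | G n b a]) & catches_limits W (G 0)].
Proof.
elim/Ppointed: L => L singL sK Winf Wnomax WL LW.
  by case: (succ_infinite sK); rewrite emptyE; apply: finite_set0.
have [D [D_mono D_cover WD LD]] := singular_filtration singL Winf WL LW.
have /choice[code code_inj] :
    forall a : K, exists f : K -> L, {in init_seg a &, injective f}.
  by move=> a; apply/pcard_injP; apply: succ_init_seg.
have [c c_cofinal] := cofinal_sequence_choice K W.
exists (approximation D code c); split.
- exact: approximation_filtration.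
- move=> n a /card_le_trans LG; apply: (LD n); apply: LG.
  exact: approximation_card_le.
- exact: approximation_catches_limits.
Qed.

Definition partial_sups d d' (W : wellOrderType d) (K : wellOrderType d')
    (xi : W -> K) (C : set W) i : set K :=
  [set y | exists j, [/\ C j, j <= i & strict_sup (xi @` init_seg j) y]].

Lemma anticipating_sequence (L J : Type) d d' (W : wellOrderType d)
    (K : wellOrderType d') (C : J -> set W) (bound : set K -> K) :
  successor_order L K -> [set: W] #<= [set: L] -> [set: J] #<= [set: L] ->
  exists2 xi : W -> K, {homo xi : i j / i < j} &
    forall i j, bound (partial_sups xi (C j) i) < xi i.
Proof.
move=> sK WL JL; have [a0 _] := successor_nonempty sK.
pose next i (f : W -> K) v :=
  (forall j, j < i -> f j < v) /\ forall j, bound (partial_sups f (C j) i) < v.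
have [||xi xiP] := @wf_recursive_choice W K a0 _ next (@lt_wf _ W).
- move=> i f f' v ff' [fv boundv].
  split=> [j ji|j]; first by rewrite -ff' // fv.
  suff <- : partial_sups f (C j) i = partial_sups f' (C j) i by [].
  have init_eq m : m <= i -> f @` init_seg m = f' @` init_seg m.
    by move=> mi; apply: eq_imagel => l lm; apply: ff'; apply: lt_le_trans mi.
  by apply/seteqP; split=> y [m [Cm mi supy]]; exists m; split=> //;
    rewrite ?init_eq // -init_eq.
- move=> i f; pose bounds := range (fun j => bound (partial_sups f (C j) i)).
  have [|v vP] := successor_bounded sK (A := f @` init_seg i `|` bounds).
    apply: (card_le_setU (succ_infinite sK)).
      apply: card_le_trans (card_image_le _ _) _.
      exact: card_le_trans (card_leT _) WL.
    exact: card_le_trans (card_image_le _ _) JL.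
  by exists v; split=> [j ji|j]; apply: vP; [left|right]; exists j.
- by exists xi => [i j ij|i j]; [apply: (xiP j).1|apply: (xiP i).2].
Qed.

Lemma uncountable_fiber T (C : set T) (f : T -> nat) :
  ~ countable C -> exists n, ~ countable (C `&` [set x | f x = n]).
Proof.
move=> Cunc; apply: contrapT => /forallNP count; apply: Cunc.
have -> : C = \bigcup_n (C `&` [set x | f x = n]).
  by apply/seteqP; split=> [x Cx|x [n _ []//]]; exists (f x).
by apply: bigcup_countable => // n _; apply: contrapT.
Qed.

Lemma uncountable_nonmaximal d (W : wellOrderType d) (C : set W) :
  ~ countable C -> ~ countable [set i | C i /\ exists2 j, C j & i < j].
Proof.
set C' := [set i | _] => Cunc C'count; apply: Cunc.
have [[m Cm max]|nomax] :=
    lem (exists2 m, C m & ~ exists2 j, C j & m < j); last first.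
  apply: card_le_trans C'count; apply: subset_card_le => i Ci; split=> //.
  by apply: contrapT => imax; apply: nomax; exists i.
have CE : C `<=` m |` C'.
  move=> i Ci; case: (ltgtP i m) => [im|mi|->]; last by left.
    by right; split=> //; exists m.
  by case: max; exists i.
apply: (card_le_trans (subset_card_le CE)).
by apply: card_le_setU; [exact: infinite_nat|exact: countable1|].
Qed.

Lemma interleaved_chain d d' (W : wellOrderType d) (K : wellOrderType d')
    (G : nat -> K -> K -> Prop) (C : set W) (s b u : W -> K) :
  order_filtration G -> ~ countable C ->
  (forall i j, C i -> i <= j -> G 0 (s i) (b j)) -> (forall j, b j < u j) ->
  (forall i j, i < j -> u i < s j) ->
  exists n B, [/\ B `<=` C, ~ countable B &
    forall i j, B i -> B j -> i < j -> G n (u i) (u j)].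
Proof.
move=> filtG /uncountable_nonmaximal; set C' := [set i | _] => C'unc sb bu us.
have /choice[next nextP] : forall i, exists i', C' i ->
    [/\ C i', i < i' & forall j, C j -> i < j -> i' <= j].
  move=> i; have [[_ [j Cj ij]]|nC'i] := lem (C' i); last by exists i.
  have [|i' [Ci' ii'] min_i'] := @ex_minimum _ W [set j | C j /\ i < j].
    by exists j.
  by exists i' => _; split=> // l Cl il; apply: min_i'.
have /choice[stage stageP] : forall i, exists n, C' i ->
    G n (b i) (u i) /\ G n (u i) (s (next i)).
  move=> i; have [C'i|nC'i] := lem (C' i); last by exists 0.
  have [_ /us /(filtration_cover filtG)[n Gn] _] := nextP i C'i.
  have [m Gm] := filtration_cover filtG (bu i).
  exists (m + n) => _.
  by split; [move: Gm|move: Gn]; apply: filtration_mono => //; lia.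
have [n Bunc] := uncountable_fiber stage C'unc.
exists n, (C' `&` [set i | stage i = n]).
split=> // [i [[Ci _] _] //|i j [C'i ni] [C'j nj] ij].
have [Cnext _ next_le] := nextP i C'i.
have [_ us_i] := stageP i C'i; rewrite ni in us_i.
have [bu_j _] := stageP j C'j; rewrite nj in bu_j.
apply: filtration_trans us_i _ => //; apply: filtration_trans bu_j => //.
apply: (filtration_mono filtG (m := 0)); first lia.
by apply: sb => //; apply: next_le => //; case: C'j.
Qed.

Section UncountableChain.
Context (L : Type) d d' (W : wellOrderType d) (K : wellOrderType d')
  (G : nat -> K -> K -> Prop) (C : W -> set W) (U : set K).
Hypotheses (sK : successor_order L K) (WL : [set: W] #<= [set: L])
  (filtG : order_filtration G) (catchG : catches_limits W (G 0))
  (guessC : forall k : W -> W,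
     exists e, ~ countable (C e) /\ C e `<=` closure_points k)
  (U_unbounded : forall x, exists2 u, U u & x < u).

Lemma bounding_function : exists bound : set K -> K, forall (X : set K) x,
  (forall y, X y -> G 0 y x) ->
  exists b u, [/\ forall y, X y -> G 0 y b, b < u, U u & u < bound X].
Proof.
suff /choice[bound boundP] : forall X : set K, exists v, forall x,
    (forall y, X y -> G 0 y x) ->
    exists b u, [/\ forall y, X y -> G 0 y b, b < u, U u & u < v].
  by exists bound.
move=> X.
have [[b Xb]|none] := lem (exists b, forall y, X y -> G 0 y b); last first.
  have [v _] := successor_nonempty sK.
  by exists v => b Xb; case: none; exists b.
have [u Uu bu] := U_unbounded b; have [v uv] := successor_gt sK u.
by exists v => _ _; exists b, u.
Qed.

Lemma interleaving_sequences : exists e (s b u : W -> K), [/\ ~ countable (C e),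
  forall i j, C e i -> i <= j -> G 0 (s i) (b j), forall j, b j < u j,
  forall j, U (u j) & forall i j, i < j -> u i < s j].
Proof.
have [bound boundP] := bounding_function.
have [xi xi_incr xi_bound] := anticipating_sequence C bound sK WL WL.
have sup_exists (A : set W) : exists y, strict_sup (xi @` A) y.
  apply: (successor_strict_sup sK); apply: card_le_trans (card_image_le _ _) _.
  exact: card_le_trans (card_leT _) WL.
have [a /(catchG xi_incr)[k catch_k]] := sup_exists setT.
have [e [Cunc Cclosed]] := guessC k.
have /choice[s sP] := fun i => sup_exists (init_seg i).
have /choice[b /choice[u buP]] : forall j, exists b u,
    [/\ forall i, C e i -> i <= j -> G 0 (s i) b, b < u, U u & u < xi j].
  move=> j; have [|b [u [Xb bu Uu uv]]] := boundP (partial_sups xi (C e) j) a.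
    by move=> y [i [Ci _ supy]]; apply: catch_k supy; apply: Cclosed.
  exists b, u; split=> // [i Ci ij|]; last exact: lt_trans uv (xi_bound j e).
  by apply: Xb; exists i.
exists e, s, b, u; split=> // [i j Ci|j|j|i j ij].
- by have [+ _ _ _] := buP j; apply.
- by have [] := buP j.
- by have [] := buP j.
- have [_ _ _ u_xi] := buP i; apply: (lt_trans u_xi).
  by apply: (proj1 (sP j)); exists i.
Qed.

Lemma uncountable_chain : exists n B, [/\ B `<=` U, ~ countable B &
  forall x y, B x -> B y -> x < y -> G n x y].
Proof.
have [e [s [b [u [Cunc sb bu Uu us]]]]] := interleaving_sequences.
have [n [B [_ Bunc Bchain]]] := interleaved_chain filtG Cunc sb bu us.
have u_incr i j : B i -> B j -> i < j -> u i < u j.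
  by move=> Bi Bj /(Bchain i j Bi Bj); apply: filtration_lt.
have u_inj : {in B &, injective u}.
  move=> i j /set_mem Bi /set_mem Bj uij.
  by case: (ltgtP i j) => // [/(u_incr _ _ Bi Bj)|/(u_incr _ _ Bj Bi)];
    rewrite uij ltxx.
exists n, (u @` B); split=> [_ [i _ <-] //||_ _ [i Bi <-] [j Bj <-] uij].
  by rewrite (eq_countable (inj_card_eq u_inj)).
apply: Bchain => //; rewrite ltNge le_eqVlt; apply/negP => /orP[/eqP ji|ji].
  by rewrite ji ltxx in uij.
by have := lt_trans uij (u_incr _ _ Bj Bi ji); rewrite ltxx.
Qed.

End UncountableChain.

Lemma uncountable_chain_filtration (L : Type) d (K : wellOrderType d) :
  singular_countable_cof L -> successor_order L K ->
  exists G : nat -> K -> K -> Prop, [/\ order_filtration G,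
    forall n a, ~ ([set: L] #<= [set b | G n b a]) &
    forall U : set K, ~ (U #<= [set: L]) ->
      exists n B, [/\ B `<=` U, ~ countable B &
        forall x y, B x -> B y -> x < y -> G n x y]].
Proof.
move=> singL sK; have [Lunc _] := singular_countable_cofE singL.
have [W1 [s1 _ LW1]] := singular_successor singL infinite_nat Lunc.
have [W2 [s2 _ LW2]] := singular_successor singL (successor_infinite s1) LW1.
have [W3 [s3 W3L LW3]] := singular_successor singL (successor_infinite s2) LW2.
have [G [filtG Gsmall catchG]] := small_order_filtration singL sK
  (successor_infinite s3) (successor_gt s3) W3L LW3.
have [C guessC] := club_guessing s1 s2 s3.
exists G; split=> // U Ularge.
apply: (uncountable_chain sK W3L filtG catchG guessC) => x.
apply: contrapT => bounded; apply: Ularge.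
apply: (successor_card_le_of_bounded sK (w := x)) => u Uu; rewrite leNgt.
by apply/negP => xu; apply: bounded; exists u.
Qed.

Lemma separating_coloring (L : pointedType) d (K : wellOrderType d)
    (G : K -> K -> Prop) :
  (forall x y, G x y -> x < y) ->
  (forall y, ~ ([set: L] #<= [set x | G x y])) ->
  exists g : K -> L, forall x y, G x y -> g x <> g y.
Proof.
move=> G_lt Gsmall.
have G_wf : well_founded G.
  by apply: (wf_incl _ _ _ _ (@lt_wf _ K)) => x y /G_lt.
have [|g [_ g_sep]] := greedy_coloring (E := setT) (B := [set: L]) G_wf.
  by move=> y _; rewrite setTI; apply: Gsmall.
by exists g => x y; apply: g_sep.
Qed.

Lemma uncountable_coordinates (L : Type) d (K : wellOrderType d) :
  singular_countable_cof L -> successor_order L K ->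
  exists X : set (nat -> L), [/\ X #= [set: K],
    forall x, exists2 f, X f & f 0 = x &
    forall Y, Y `<=` X -> ~ (Y #<= [set: L]) ->
      exists n, ~ countable [set f n | f in Y]].
Proof.
elim/Ppointed: L => L singL sK.
  by case: (succ_infinite sK); rewrite emptyE; apply: finite_set0.
have [G [filtG Gsmall Gchain]] := uncountable_chain_filtration singL sK.
have /choice[g g_sep] :
    forall n, exists g : K -> L, forall b a, G n b a -> g b <> g a.
  by move=> n; apply: separating_coloring => // x y; apply: filtration_lt.
have /pcard_surjP[s s_surj] := successor_ge_base sK.
(* The first coordinate makes every element of [L] occur in the tree. *)
pose F a n := if n is S m then g m a else s a.
have F_sep n b a : G n b a -> F b (S n) <> F a (S n) by apply: g_sep.
have F_inj : injective F.
  move=> b a Fba; case: (ltgtP b a) => // /(filtration_cover filtG)[n /F_sep];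
  by rewrite Fba.
exists (range F); split=> [|x|Y YF Ylarge].
- by apply: inj_card_eq => b a _ _; apply: F_inj.
- by have [a _ <-] := s_surj x I; exists (F a) => //; exists a.
have [|n [B [BY Bunc Bchain]]] := Gchain (F @^-1` Y).
  move=> preY; apply: Ylarge; apply: card_le_trans preY.
  apply: card_le_trans (card_image_le F _); apply: subset_card_le => f Yf.
  by have [a _ fa] := YF f Yf; exists a => //; rewrite /preimage /= fa.
exists (S n) => Ycount; apply: Bunc.
have FB_inj : {in B &, injective (F^~ (S n))}.
  move=> b a /set_mem Bb /set_mem Ba Fba.
  by case: (ltgtP b a) => // [/(Bchain _ _ Bb Ba)|/(Bchain _ _ Ba Bb)] /F_sep;
    rewrite Fba.
rewrite -(eq_countable (inj_card_eq FB_inj)).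
apply: card_le_trans Ycount; apply: subset_card_le => _ [b /BY Yb <-].
by exists (F b).
Qed.

(** * Trees and T-graphs *)

Lemma finite_type_sig T (P : T -> Prop) (l : list T) :
  (forall x, P x -> In x l) -> finite_type {x | P x}.
Proof.
move=> Pl.
pose lift x := if pselect (P x) is left Px then exist P x Px :: nil else nil.
exists (flat_map lift l) => -[x Px]; apply/in_flat_map.
exists x; split; first exact: Pl.
rewrite /lift; case: pselect => // Px'.
by left; congr exist; apply: Prop_irrelevance.
Qed.

Lemma infinite_type_of_unbounded T (size : T -> nat) :
  (forall n, exists x, (n <= size x)%nat) -> infinite_type T.
Proof.
move=> unb [l all_in]; pose m := list_max (List.map size l).
have /list_max_le/Forall_forall le_max := PeanoNat.Nat.le_refl m.
have [x] := unb (S m).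
by have := le_max (size x) (in_map size l x (all_in x)); rewrite -/m; lia.
Qed.

Section Tree.
Context (L : Type).
Implicit Types (s t : list L) (f : nat -> L) (X : (nat -> L) -> Prop).

Lemma prefix_ofP s f :
  prefix_of s f <-> forall n x, (n < length s)%nat -> List.nth n s x = f n.
Proof.
split=> [-> n x|nth_s].
  rewrite length_map length_seq => ns.
  by rewrite (nth_indep _ x (f 0)) ?length_map ?length_seq // map_nth seq_nth.
apply: (nth_ext _ _ (f 0) (f 0)) => [|n ns].
  by rewrite length_map length_seq.
by rewrite map_nth seq_nth // nth_s.
Qed.

Lemma prefix_of_map f n : prefix_of (List.map f (List.seq 0 n)) f.
Proof. by rewrite /prefix_of length_map length_seq. Qed.

Lemma prefix_of_app s t f : prefix_of (s ++ t) f -> prefix_of s f.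
Proof.
move=> /prefix_ofP st; apply/prefix_ofP => n x ns.
by rewrite -(st n x) ?app_nth1 // length_app; lia.
Qed.

Lemma long_prefix (P : list L -> Prop) f n :
  infinite_type {s | P s} -> (forall s, P s -> prefix_of s f) ->
  exists2 s, P s & (n < length s)%nat.
Proof.
move=> Pinf Ppre; apply: contrapT => short; apply: Pinf.
apply: (@finite_type_sig _ _
  (List.map (fun k => List.map f (List.seq 0 k)) (List.seq 0 (S n)))) => s Ps.
apply/in_map_iff; exists (length s); split; first by rewrite -(Ppre s Ps).
apply/in_seq; suff : ~ (n < length s)%nat by lia.
by move=> ns; apply: short; exists s.
Qed.

Definition comparability_graph X (u v : tnode L) : Prop :=
  [/\ downclosure X u, downclosure X v & tlt u v \/ tlt v u].

Lemma tlt_irrefl (u : tnode L) : ~ tlt u u.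
Proof.
case: u => [s [w [w_nil sw]]|f []]; apply: w_nil; apply: (app_inv_head s).
by rewrite app_nil_r.
Qed.

Lemma downclosure_tlt X (u v : tnode L) :
  downclosure X v -> tlt u v -> downclosure X u.
Proof.
case: u => [s|f _ []]; case: v => [t|f] /=; last by move=> Xf sf; exists f.
move=> [f [Xf tf]] [w [_ tE]]; exists f; split=> //.
by apply: (@prefix_of_app _ w); rewrite -tE.
Qed.

Lemma comparability_T_graph X : T_graph X (comparability_graph X).
Proof.
split; last split; last split; last split.
- by move=> u v [].
- by move=> u v [Xu Xv uv]; split=> //; case: uv; [right|left].
- by move=> u [_ _ []]; apply: tlt_irrefl.
- by move=> u v [_ _ [uv|vu]]; [left|right]; right.
- move=> v Xv u uv; exists u; split; first by left.
  by split=> //; split=> //; [apply: downclosure_tlt uv|left].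
Qed.

Section TGraph.
Context X (G : tnode L -> tnode L -> Prop) (TG : T_graph X G).

Lemma Tedge_prefix s f : Tedge G s f -> prefix_of s f.
Proof. by case: TG => _ [_ [_ [comp _]]] /comp[[]|[]]. Qed.

Lemma T_graph_infinite_degree f :
  X f -> infinite_type {s | Tfin X s /\ Tedge G s f}.
Proof.
case: TG => Gdown [_ [_ [_ Gcof]]] Xf.
pose depth (s : {s | Tfin X s /\ Tedge G s f}) := length (proj1_sig s).
apply: (infinite_type_of_unbounded (size := depth)) => n.
have [[t|g] [sr [rf Grf]]] :=
  Gcof (Inf f) Xf (Fin _) (prefix_of_map f n); last by [].
have nt : (n <= length t)%nat.
  have <- : length (List.map f (List.seq 0 n)) = n.
    by rewrite length_map length_seq.
  by case: sr => [[<-]|[w [_ ->]]]; rewrite ?length_app; lia.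
have Tt : Tfin X t /\ Tedge G t f by split=> //; have [] := Gdown _ _ Grf.
by exists (exist _ t Tt).
Qed.

Lemma T_graph_no_aleph0_subgraph (K : Type) :
  (forall Y : set (nat -> L), Y `<=` X -> [set: K] #<= Y ->
     exists n, ~ countable [set f n | f in Y]) ->
  ~ has_aleph0_subgraph K (Tfin X) X (Tedge G).
Proof.
move=> Xunc [C [D [E [_ [DX [EG]]]]]].
move=> [/card_eq_typeP CN [/card_eq_typeP DK Einf]].
have /card_eqPle[CN' _] := card_eq_trans (card_esym (card_sig C)) CN.
have /card_eqPle[_ KD] := card_eq_trans (card_esym (card_sig D)) DK.
have [n] := Xunc D DX KD; apply; apply: card_le_trans CN'.
apply: (card_le_rel (R := fun x s =>
  exists f, [/\ prefix_of s f, (n < length s)%nat & f n = x])).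
  move=> _ [f Df <-].
  have [|s [Cs Esf] ns] := long_prefix (f := f) n (Einf f Df).
    by move=> s [_ /EG/Tedge_prefix].
  by exists s => //; exists f; split=> //; apply: Tedge_prefix (EG _ _ Esf).
move=> x x' s _ _ [f [/prefix_ofP sf ns <-]] [f' [/prefix_ofP sf' _ <-]].
by rewrite -(sf n (f n)) // sf'.
Qed.

Lemma graph_of_type_T_of_card (K : Type) :
  infinite_set [set: L] -> (X : set _) #= [set: K] ->
  (forall x, exists2 f, X f & f 0 = x) ->
  graph_of_type_T K X G.
Proof.
move=> Linf XK roots.
have XK' : Defs.card_eq {f | X f} K.
  by apply/card_eq_typeP; rewrite (card_eql (card_sig X)).
do !split=> //; last exact: T_graph_infinite_degree.
apply/card_eq_typeP; rewrite (card_eql (card_sig (Tfin X))).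
apply/card_eqPle; split.
  exact: card_le_trans (card_leT _) (card_list_infinite Linf).
apply: (card_le_rel (R := fun x s => s = x :: nil)); last first.
  by move=> x x' s _ _ -> [].
move=> x _; have [f Xf <-] := roots x.
by exists (f 0 :: nil) => //; exists f.
Qed.

End TGraph.
End Tree.

Theorem theorem7p1 :
  forall (L K : Type),
    singular_countable_cof L ->
    is_successor_card L K ->
    exists (X : (nat -> L) -> Prop) (G : tnode L -> tnode L -> Prop),
      graph_of_type_T K X G /\
      ~ has_aleph0_subgraph K (Tfin X) X (Tedge G).
Proof.
move=> L K singL succK.
have [Lunc _] := singular_countable_cofE singL.
have Linf := contra_not (@finite_set_countable _ _) Lunc.
have [W [sW WK]] := successor_card_order Linf succK.
have [X [XW X_roots X_unc]] := uncountable_coordinates singL sW.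
have TG := comparability_T_graph X.
exists X, (comparability_graph X); split.
  by apply: (graph_of_type_T_of_card TG Linf (card_eq_trans XW WK)).
apply: (T_graph_no_aleph0_subgraph TG) => Y YX KY; apply: X_unc YX _ => YL.
apply: (succ_large sW); apply: card_le_trans YL.
by have /card_eqPle[WK' _] := WK; apply: card_le_trans WK' KY.
Qed.
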